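(* Let $G$ be a directed planar embedded graph with non-negative arc capacities, source set $S$ and sink set $T\subseteq V(G)\setminus S$. The flow computed by the algorithm MultipleSourceMultipleSinkMaxFlow$(G,S,T)$ described below is a maximum feasible flow from $S$ to $T$ in $G$.
   Context: Flow notions: each arc $a$ with capacity $c(a)$ gives a dart in its direction with capacity $c(a)$ and a reverse dart with capacity $0$. A flow assignment $f$ is a real function on darts with $f(\mathrm{rev}(d))=-f(d)$; $\mathrm{inflow}_f(v)=\sum_{a:\mathrm{head}(a)=v}f(a)-\sum_{a:\mathrm{tail}(a)=v}f(a)$. A feasible flow respects capacities ($f(d)\le c(d)$) and has zero inflow at every node not in $S\cup T$; its value is $\sum_{t\in T}\mathrm{inflow}_f(t)$; a maximum feasible flow is one of maximum value. Residual capacity is $c_f(d)=c(d)-f(d)$; a residual path uses only darts with positive residual capacity. The algorithm maintains one global flow assignment $f$ (initially $0$). Every subroutine call below operates on the current residual capacities $c_f$ of the relevant subgraph, computes a flow $\hat f$ there, and then sets $f(d):=f(d)+\hat f(d)$ (''pushes'' $\hat f$). Subroutines: MultipleSourceSingleSinkMaxFlow$(H,S',t)$ computes a maximum flow in $H$ from source set $S'$ to the single sink $t$; SingleSourceMultipleSinkMaxFlow$(H,s,T')$ computes a maximum flow from single source $s$ to sink set $T'$; SingleSourceSingleSinkLimitedMaxFlow$(H,s,t,\Delta)$ computes an $s$-to-$t$ flow whose value is the minimum of $\Delta$ and the maximum $s$-to-$t$ flow value. (For graphs of constant size the algorithm computes a maximum flow directly.) MultipleSourceMultipleSinkMaxFlow$(G,S,T)$: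 1. Find a Jordan curve $C$ meeting the embedding of $G$ only at nodes (the boundary nodes), with at most $2\sqrt{2}\sqrt{n}$ boundary nodes and at most $2n/3$ nodes strictly inside and at most $2n/3$ strictly outside. Let $G_1$ be the subgraph of nodes and edges enclosed by $C$ (including boundary nodes) and $G_2$ the subgraph of nodes and edges not strictly enclosed by $C$ (including boundary nodes). 2. For $i=1,2$: (a) recursively call MultipleSourceMultipleSinkMaxFlow$(G_i,S\cap G_i,T\cap G_i)$; (b) add to $G_i$ a new node $v^\star$, embedded in the face of $G_i$ resulting from deleting the arcs of $G$ not in $G_i$, joined to every boundary node by infinite-capacity arcs in both directions; (c) call MultipleSourceSingleSinkMaxFlow$(G_i,S\cap G_i,v^\star)$; (d) call SingleSourceMultipleSinkMaxFlow$(G_i,v^\star,T\cap G_i)$; (e) remove $v^\star$ and its arcs. 3. Let the boundary nodes, in cyclic order along $C$, be $p_1,\dots,p_k$. For $i=1,\dots,k$: add infinite-capacity bidirectional artificial arcs $p_{i+1}p_{i+2},p_{i+2}p_{i+3},\dots,p_{k-1}p_k$; if $\mathrm{inflow}_f(p_i)>0$ call SingleSourceSingleSinkLimitedMaxFlow$(G,p_i,p_{i+1},\mathrm{inflow}_f(p_i))$, otherwise call SingleSourceSingleSinkLimitedMaxFlow$(G,p_{i+1},p_i,|\mathrm{inflow}_f(p_i)|)$; then remove the artificial arcs. 4. Push flow from boundary nodes with positive inflow back to sources, and to boundary nodes with negative inflow from sinks, so that every boundary node ends with zero inflow. *)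

(* Defs.v *)
From HB Require Import structures.
From mathcomp Require Import all_boot all_order all_algebra.
From mathcomp Require Import all_classical all_reals all_analysis.

Set Implicit Arguments.
Unset Strict Implicit.
Unset Printing Implicit Defensive.

Import Order.TTheory GRing.Theory Num.Theory.
Import numFieldNormedType.Exports.

Local Open Scope ring_scope.

(* Directed multigraphs (loops and parallel arcs allowed).  The node and arc
   sets are carried separately from the ambient types so that a subgraph lives
   over the same types, and one global flow assignment serves all of them. *)
Record digraph (V A : finType) := Digraph {
  tail : A -> V;
  head : A -> V;
  nodes : {set V};
  arcs : {set A} }.

Definition wf_digraph (V A : finType) (G : digraph V A) : Prop :=
  forall a, a \in arcs G -> tail G a \in nodes G /\ head G a \in nodes G.

Definition subdigraph (V A : finType) (G : digraph V A)
    (N : {set V}) (E : {set A}) : digraph V A :=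
  Digraph (tail G) (head G) N E.

(* [(a, true)] is the dart of [a] in the direction of [a], [(a, false)] its
   reverse. *)
Definition dart (A : Type) : Type := (A * bool)%type.

Definition rev_dart (A : Type) (d : dart A) : dart A := (d.1, ~~ d.2).

Section Flows.
Variables (R : realType) (V A : finType).
Implicit Types (G : digraph V A) (f g : dart A -> R) (c : dart A -> \bar R).
Implicit Types (S T : {set V}).

Definition arc_capacity (c : A -> R) (d : dart A) : \bar R :=
  if d.2 then (c d.1)%:E else 0%E.

(* A function on the darts of [G] is represented by its extension by zero to
   the darts of the ambient arc type. *)
Definition flow_assignment G f : Prop :=
  (forall d, f (rev_dart d) = - f d) /\
  (forall d, d.1 \notin arcs G -> f d = 0).

Definition inflow G f (v : V) : R :=
  \sum_(a in arcs G | head G a == v) f (a, true) -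
  \sum_(a in arcs G | tail G a == v) f (a, true).

Definition feasible_flow G c S T f : Prop :=
  [/\ flow_assignment G f,
      forall d, d.1 \in arcs G -> ((f d)%:E <= c d)%E &
      forall v, v \in nodes G -> v \notin S :|: T -> inflow G f v = 0].

Definition flow_value G T f : R := \sum_(t in T) inflow G f t.

Definition max_flow G c S T f : Prop :=
  feasible_flow G c S T f /\
  (forall g, feasible_flow G c S T g -> flow_value G T g <= flow_value G T f).

(* The maximum s-to-t value is taken as a supremum in the extended reals. *)
Definition limited_max_flow G c (s t : V) (Delta : R) f : Prop :=
  feasible_flow G c [set s] [set t] f /\
  (flow_value G [set t] f)%:E =
    mine Delta%:E
      (ereal_sup (fun x : \bar R => exists2 g : dart A -> R,
         feasible_flow G c [set s] [set t] g &
         x = (flow_value G [set t] g)%:E)).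

Definition residual c f : dart A -> \bar R := fun d => (c d - (f d)%:E)%E.

End Flows.

(* Auxiliary arcs are the right summands of [A + B].  Each stands for an
   infinite-capacity connection in both directions: both of its darts have
   capacity +oo, hence residual capacity +oo whatever flow they carry. *)
Definition aux_capacity (R : realType) (A B : finType)
    (c : dart A -> \bar R) : dart (A + B)%type -> \bar R :=
  fun d => match d.1 with inl a => c (a, d.2) | inr _ => +oo%E end.

Definition drop_aux (R : realType) (A B : finType)
    (f : dart (A + B)%type -> R) : dart A -> R :=
  fun d => f (inl d.1, d.2).

(* [add_apex G P] adds the node v* = [None], joined to every node of [P]. *)
Definition add_apex (V A : finType) (G : digraph V A) (P : {set V}) :
    digraph (option V) (A + V)%type :=
  Digraph
    (fun e => match e with inl a => Some (tail G a) | inr p => Some p end)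
    (fun e => match e with inl a => Some (head G a) | inr _ => None end)
    (None |: [set Some v | v in nodes G])
    ([set inl a | a in arcs G] :|: [set inr p | p in P]).

(* [add_path G q] joins consecutive entries of [q]. *)
Definition add_path (V A : finType) (G : digraph V A) (q : seq V) :
    digraph V (A + V * V)%type :=
  Digraph
    (fun e => match e with inl a => tail G a | inr uw => uw.1 end)
    (fun e => match e with inl a => head G a | inr uw => uw.2 end)
    (nodes G)
    ([set inl a | a in arcs G] :|:
     [set inr uw | uw in [set:: zip q (behead q)]]).

Record drawing (R : realType) (V A : finType) := Drawing {
  node_pos : V -> R * R;
  arc_curve : A -> R -> R * R }.

Section Plane.
Variables (R : realType) (V A : finType).
Implicit Types (G : digraph V A) (D : drawing R V A) (gamma : R -> R * R).

Definition open_arc D (a : A) : set (R * R) :=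
  (arc_curve D a @` `]0, 1[)%classic.

Definition planar_embedding G D : Prop :=
  [/\ {in nodes G &, injective (node_pos D)},
      forall a, a \in arcs G ->
        [/\ ({within `[0, 1], continuous (arc_curve D a)})%classic,
            arc_curve D a 0 = node_pos D (tail G a),
            arc_curve D a 1 = node_pos D (head G a) &
            {in `]0, 1[ &, injective (arc_curve D a)}],
      forall a v, a \in arcs G -> v \in nodes G ->
        ~ open_arc D a (node_pos D v) &
      forall a b, a \in arcs G -> b \in arcs G -> a != b ->
        (open_arc D a `&` open_arc D b = set0)%classic].

Definition jordan_curve gamma : Prop :=
  [/\ ({within `[0, 1], continuous gamma})%classic,
      gamma 0 = gamma 1 &
      {in `[0, 1[ &, injective gamma}].

Definition curve_image gamma : set (R * R) := (gamma @` `[0, 1])%classic.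

Definition strictly_inside gamma (x : R * R) : Prop :=
  ~ curve_image gamma x /\
  bounded_set (connected_component (~` curve_image gamma)%classic x).

Definition strictly_outside gamma (x : R * R) : Prop :=
  ~ curve_image gamma x /\
  ~ bounded_set (connected_component (~` curve_image gamma)%classic x).

Definition boundary G D gamma : {set V} :=
  [set v in nodes G | `[< curve_image gamma (node_pos D v) >]].

Definition inside_nodes G D gamma : {set V} :=
  [set v in nodes G | `[< strictly_inside gamma (node_pos D v) >]].

Definition outside_nodes G D gamma : {set V} :=
  [set v in nodes G | `[< strictly_outside gamma (node_pos D v) >]].

Definition enclosed_arcs G D gamma : {set A} :=
  [set a in arcs G |
    `[< forall x, open_arc D a x -> strictly_inside gamma x >]].

Definition separator G D gamma : Prop :=
  [/\ jordan_curve gamma,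
      forall a, a \in arcs G -> (open_arc D a `&` curve_image gamma = set0)%classic,
      #|boundary G D gamma|%:R
        <= 2 * Num.sqrt 2 * Num.sqrt (#|nodes G|%:R) :> R,
      (3 * #|inside_nodes G D gamma| <= 2 * #|nodes G|)%N &
      (3 * #|outside_nodes G D gamma| <= 2 * #|nodes G|)%N].

(* The starting point and the orientation are those of the parametrization. *)
Definition boundary_order G D gamma (p : seq V) : Prop :=
  p =i boundary G D gamma /\
  exists ts : seq R,
    [/\ sorted <%R ts, all (fun t => 0 <= t < 1) ts &
        map gamma ts = map (node_pos D) p].

Definition inner_part G D gamma : digraph V A :=
  subdigraph G (boundary G D gamma :|: inside_nodes G D gamma)
               (enclosed_arcs G D gamma).

Definition outer_part G D gamma : digraph V A :=
  subdigraph G (nodes G :\: inside_nodes G D gamma)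
               (arcs G :\: enclosed_arcs G D gamma).

End Plane.

Section Algorithm.
Variables (R : realType) (V A : finType).
(* The capacities of the darts of the input graph. *)
Variable c : dart A -> \bar R.
Implicit Types (G H : digraph V A) (f g h : dart A -> R) (S T : {set V}).

(* Maximum flow from S to v*, then from v* to T, in [H] plus v*.  If a node of
   [P] is a terminal then one of these values is unbounded, no maximum flow
   exists, and the relation is empty. *)
Definition apex_phase H (P S T : {set V}) f f' : Prop :=
  exists g h : dart (A + V)%type -> R,
  let H' := add_apex H P in
  let f1 := f \+ drop_aux g in
  [/\ max_flow H' (aux_capacity (residual c f))
        [set Some v | v in S] [set None] g,
      max_flow H' (aux_capacity (residual c f1))
        [set None] [set Some v | v in T] h &
      f' = f1 \+ drop_aux h].

(* One pass over the boundary nodes in order; the last one has no successor. *)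
Inductive boundary_sweep H :
    seq V -> (dart A -> R) -> (dart A -> R) -> Prop :=
| Sweep_nil f : boundary_sweep H [::] f f
| Sweep_last p f : boundary_sweep H [:: p] f f
| Sweep_step p q r f f' (g : dart (A + V * V)%type -> R) :
    (if 0 < inflow H f p
     then limited_max_flow (add_path H (q :: r))
            (aux_capacity (residual c f)) p q (inflow H f p) g
     else limited_max_flow (add_path H (q :: r))
            (aux_capacity (residual c f)) q p `|inflow H f p| g) ->
    boundary_sweep H (q :: r) (f \+ drop_aux g) f' ->
    boundary_sweep H (p :: q :: r) f f'.

Definition return_excess H (P S T : {set V}) f f' : Prop :=
  exists g h,
  let f1 := f \+ g in
  [/\ feasible_flow H (residual c f) [set p in P | 0 < inflow H f p] S g,
      feasible_flow H (residual c f1) T [set p in P | inflow H f p < 0] h,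
      f' = f1 \+ h &
      forall p, p \in P -> inflow H f' p = 0].

Variables (D : drawing R V A) (n0 : nat).

(* [msms_max_flow H S T f f']: some execution on [H] turns the flow assignment
   [f] into [f'].  The separators and the flows returned by the subroutines are
   arbitrary subject to their specifications; graphs with at most [n0] nodes
   are solved directly.  Inflows are taken in the graph of the current call. *)
Inductive msms_max_flow :
    digraph V A -> {set V} -> {set V} ->
    (dart A -> R) -> (dart A -> R) -> Prop :=
| Msms_small H S T f g :
    (#|nodes H| <= n0)%N ->
    max_flow H (residual c f) S T g ->
    msms_max_flow H S T f (f \+ g)
| Msms_split H S T gamma p f0 f1 f2 f3 f4 f5 f6 :
    (n0 < #|nodes H|)%N ->
    separator H D gamma ->
    boundary_order H D gamma p ->
    let P := boundary H D gamma in
    let H1 := inner_part H D gamma in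
    let H2 := outer_part H D gamma in
    msms_max_flow H1 (S :&: nodes H1) (T :&: nodes H1) f0 f1 ->
    apex_phase H1 P (S :&: nodes H1) (T :&: nodes H1) f1 f2 ->
    msms_max_flow H2 (S :&: nodes H2) (T :&: nodes H2) f2 f3 ->
    apex_phase H2 P (S :&: nodes H2) (T :&: nodes H2) f3 f4 ->
    boundary_sweep H p f4 f5 ->
    return_excess H P S T f5 f6 ->
    msms_max_flow H S T f0 f6.

End Algorithm.

(* Main.v *)
(* Residual reachability is handled through cuts: a node set X is saturated when
   every dart leaving X has flow equal to its capacity, and S is separated from T
   when some saturated X contains S and avoids T.  Pushing a flow whose terminals
   lie all inside or all outside X keeps X saturated, since the net flow out of X
   is zero and no dart leaving X can gain flow.
   In each piece the recursive call and the two apex flows yield cuts separating S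
   from T and the boundary P, and S and P from T; pieces share only P, so these cuts
   glue to cuts of the whole graph, and the sweep preserves them.  Iteration i of the
   sweep either zeroes the inflow of p_i or leaves a cut between p_i and all later
   boundary nodes, so that no boundary node with excess reaches one with deficit.
   Hence S and the boundary nodes with excess are separated from T and the boundary
   nodes with deficit; returning the excess preserves this cut, which certifies
   maximality.  Planarity enters only through the two pieces being subgraphs: arcs
   do not cross the Jordan curve, so the ends of an arc lie on the curve or on the
   side of the arc. *)
From mathcomp Require Import all_boot all_order all_algebra.
From mathcomp Require Import all_classical all_reals all_analysis.
From mathcomp Require Import lra.
Require Import Defs.

Set Implicit Arguments.
Unset Strict Implicit.
Unset Printing Implicit Defensive.

Import Order.TTheory GRing.Theory Num.Theory.
Import numFieldNormedType.Exports.

Local Open Scope ring_scope.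

(** * Net flow across a cut, and saturated cuts as certificates of maximality *)

Section Cuts.
Variables (R : realType) (V A : finType).
Implicit Types (G : digraph V A) (f g : dart A -> R) (c : dart A -> \bar R).
Implicit Types (S T X W : {set V}).

Definition dart_tail G (d : dart A) : V := if d.2 then tail G d.1 else head G d.1.

Definition dart_head G (d : dart A) : V := if d.2 then head G d.1 else tail G d.1.

Definition leaves G X (d : dart A) : bool :=
  [&& d.1 \in arcs G, dart_tail G d \in X & dart_head G d \notin X].

Definition capacity_respecting G c f : Prop :=
  forall d, d.1 \in arcs G -> ((f d)%:E <= c d)%E.

(** The equality is in the extended reals, so it also says that no dart of infinite capacity leaves
    [X]. *)
Definition saturated G c f X : Prop :=
  forall d, leaves G X d -> c d = (f d)%:E.

(* By max-flow min-cut this is the absence of residual paths from [S] to [T],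
   in the form of a cut. *)
Definition separated G c f S T : Prop :=
  exists X, [/\ S \subset X, [disjoint X & T] & saturated G c f X].

Lemma rev_dartK : involutive (@rev_dart A).
Proof. by case=> a b; rewrite /rev_dart /= negbK. Qed.

Lemma dart_tail_rev G d : dart_tail G (rev_dart d) = dart_head G d.
Proof. by case: d => a []. Qed.

Lemma dart_head_rev G d : dart_head G (rev_dart d) = dart_tail G d.
Proof. by case: d => a []. Qed.

Lemma wf_dart_tail G d : wf_digraph G -> d.1 \in arcs G -> dart_tail G d \in nodes G.
Proof. by case: d => a [] wfG /wfG[]. Qed.

Lemma wf_dart_head G d : wf_digraph G -> d.1 \in arcs G -> dart_head G d \in nodes G.
Proof. by case: d => a [] wfG /wfG[]. Qed.

Lemma inflow_darts G f v : (forall d, f (rev_dart d) = - f d) ->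
  inflow G f v = \sum_(d : dart A | (d.1 \in arcs G) && (dart_head G d == v)) f d.
Proof.
move=> fN; rewrite big_mkcond /=.
have -> (F : dart A -> R) : \sum_(d : dart A) F d = \sum_a (F (a, true) + F (a, false)).
  rewrite (eq_bigr (fun d : dart A => F (d.1, d.2))); last by case.
  by rewrite -(pair_bigA _ (fun a b => F (a, b))) /=; apply: eq_bigr => a _; rewrite big_bool.
rewrite big_split /= /inflow -sumrN; congr (_ + _); rewrite big_mkcond /=;
  apply: eq_bigr => a _ //=.
by rewrite /dart_head /=; case: ifP => // _; rewrite -(fN (a, true)).
Qed.

(** Darts with both ends in [W] cancel against their reverses; the remaining darts into [W] are the
    reverses of those leaving it. *)
Lemma sum_inflow_cut G f W : (forall d, f (rev_dart d) = - f d) ->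
  \sum_(v in W) inflow G f v = - \sum_(d | leaves G W d) f d.
Proof.
move=> fN.
rewrite (eq_bigr _ (fun v _ => inflow_darts G v fN)).
have revK (P : pred (dart A)) : \sum_(d | P d) f d = - \sum_(d | P (rev_dart d)) f d.
  rewrite (reindex_inj (inv_inj rev_dartK)) /= -sumrN.
  by apply: eq_bigr => d _; rewrite fN.
have -> : \sum_(v in W) \sum_(d : dart A | (d.1 \in arcs G) && (dart_head G d == v)) f d =
    \sum_(d : dart A | (d.1 \in arcs G) && (dart_head G d \in W)) f d.
  rewrite (exchange_big_dep (fun d : dart A => (d.1 \in arcs G) && (dart_head G d \in W))) /=.
    apply: eq_bigr => d /andP[dG dW].
    rewrite (big_pred1 (dart_head G d)) // => v /=.
    by rewrite dG /= eq_sym; case: eqP => [->|]; rewrite ?dW ?andbF.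
  by move=> v d vW /andP[-> /eqP->].
rewrite (bigID (fun d => dart_tail G d \in W)) /=.
set s := (X in X + _); have s0 : s = 0.
  have : s = - s.
    rewrite {1}/s revK; congr (- _); apply: eq_bigl => d /=.
    by rewrite dart_head_rev dart_tail_rev -!andbA [(_ \in W) && _]andbC.
  lra.
rewrite s0 add0r revK; congr (- _); apply: eq_bigl => d /=.
by rewrite dart_head_rev dart_tail_rev /leaves -andbA.
Qed.

Lemma inflow0 G v : inflow G (fun _ : dart A => 0 : R) v = 0.
Proof. by rewrite /inflow !big1 // subr0. Qed.

Lemma inflowD G f g v : inflow G (fun d => f d + g d) v = inflow G f v + inflow G g v.
Proof. by rewrite /inflow !big_split /= opprD addrACA. Qed.

Lemma inflowZ G k f v : inflow G (fun d => k * f d) v = k * inflow G f v.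
Proof. by rewrite /inflow -!mulr_sumr mulrBr. Qed.

Lemma eq_inflow G f g v :
  (forall d, d.1 \in arcs G -> f d = g d) -> inflow G f v = inflow G g v.
Proof.
by move=> fg; rewrite /inflow; congr (_ - _); apply: eq_bigr => a /andP[aG _]; rewrite fg.
Qed.

Lemma inflow_out G f v : wf_digraph G -> v \notin nodes G -> inflow G f v = 0.
Proof.
move=> wfG vG; rewrite /inflow !big_pred0 ?subr0 // => a;
  by apply/negP => /andP[/wfG[tG hG] /eqP av]; rewrite -av ?tG ?hG in vG.
Qed.

(** No dart leaves the set of all nodes, so the total inflow is zero, and it is carried by [W]
    alone. *)
Lemma sum_inflow_eq0 G f W W' : (forall d, f (rev_dart d) = - f d) ->
    (forall v, v \notin W -> inflow G f v = 0) ->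
    W \subset W' \/ [disjoint W & W'] -> \sum_(v in W') inflow G f v = 0.
Proof.
move=> fN f0 [sWW'|dWW']; last first.
  by rewrite big1 // => v vW'; apply: f0; apply: contraL dWW' => vW;
    apply/pred0Pn; exists v; rewrite /= vW vW'.
have := sum_inflow_cut G [set: V] fN.
rewrite [X in _ = - X]big_pred0 ?oppr0; last by move=> d; rewrite /leaves !inE !andbF.
rewrite (bigID (mem W')) /= [X in _ + X]big1 ?addr0; last first.
  by move=> v /andP[_ vW']; apply: f0; apply: contra vW' => /(fintype.subsetP sWW').
by move=> s0; rewrite -[RHS]s0; apply: eq_bigl => v; rewrite inE.
Qed.

(** The net flow out of [W] is zero, and a vanishing sum of terms of one sign has only zero
    terms. *)
Lemma cut_flow_ge0_eq0 G f W : (forall d, f (rev_dart d) = - f d) ->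
    (forall d, leaves G W d -> 0 <= f d) -> \sum_(v in W) inflow G f v = 0 ->
  forall d, leaves G W d -> f d = 0.
Proof.
move=> fN f0; rewrite sum_inflow_cut // => /eqP; rewrite oppr_eq0 => /eqP.
exact: (psumr_eq0P f0).
Qed.

Lemma cut_flow_le0_eq0 G f W : (forall d, f (rev_dart d) = - f d) ->
    (forall d, leaves G W d -> f d <= 0) -> \sum_(v in W) inflow G f v = 0 ->
  forall d, leaves G W d -> f d = 0.
Proof.
move=> fN f0; rewrite sum_inflow_cut // => /eqP; rewrite oppr_eq0 => /eqP.
rewrite -[X in X = 0]opprK -sumrN => /eqP; rewrite oppr_eq0 => /eqP sf d dW.
have := psumr_eq0P (P := leaves G W) (F := fun d => - f d) _ sf dW.
by move/(_ _)/eqP; rewrite oppr_eq0 => /(_ _)/eqP; apply => e eW; rewrite oppr_ge0 f0.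
Qed.

Lemma feasible_inflow0 G c S T f v : wf_digraph G -> feasible_flow G c S T f ->
  v \notin S :|: T -> inflow G f v = 0.
Proof.
move=> wfG [_ _ f0] vST; have [vG|/inflow_out->//] := boolP (v \in nodes G).
exact: f0.
Qed.

Lemma saturatedU G c f X Y : saturated G c f X -> saturated G c f Y ->
  saturated G c f (X :|: Y).
Proof.
move=> sX sY d /and3P[dG]; rewrite !inE negb_or => /orP[dX|dY] /andP[hX hY].
  by apply: sX; apply/and3P.
by apply: sY; apply/and3P.
Qed.

(** Weak duality: the value of every feasible flow is its net flow out of [X], and [f] attains the
    capacity on each dart leaving [X]. *)
Lemma separated_max_flow G c S T f : wf_digraph G -> [disjoint S & T] ->
  feasible_flow G c S T f -> separated G c f S T -> max_flow G c S T f.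
Proof.
move=> wfG dST ff [X [sSX dXT sX]]; split=> // g gf.
have value h : feasible_flow G c S T h -> flow_value G T h = \sum_(d | leaves G X d) h d.
  move=> hf; have hN : forall d, h (rev_dart d) = - h d by case: hf => [[]].
  rewrite -[RHS]opprK -sum_inflow_cut // /flow_value.
  (* [X :|: T] contains all terminals, and [X] and [T] are disjoint, so the inflows into [T] and
     into [X] are opposite. *)
  have ST0 : \sum_(v in X :|: T) inflow G h v = 0.
    apply: (@sum_inflow_eq0 G h (S :|: T)) => //; last by left; rewrite finset.setSU.
    by move=> v; apply: feasible_inflow0 hf.
  rewrite (eq_bigl (fun v => (v \in X) || (v \in T))) in ST0; last by move=> v; rewrite inE.
  by rewrite bigU //= in ST0; lra.
rewrite !value //; apply: ler_sum => d dX; rewrite -lee_fin -sX //.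
by case: gf => _ gc _; apply: gc; case/and3P: dX.
Qed.

End Cuts.

(** * Augmenting flows, and the cut left by a maximum flow *)

Section MaxFlowCut.
Variables (R : realType) (V A : finType).
Implicit Types (G : digraph V A) (f g : dart A -> R) (c : dart A -> \bar R).
Implicit Types (S T X W : {set V}).

Definition residual_step G c f : rel V := fun u v =>
  [exists d : dart A, [&& d.1 \in arcs G, dart_tail G d == u, dart_head G d == v &
    ((f d)%:E < c d)%E]].

(** One unit of flow along [d]; the second indicator makes it antisymmetric under reversal. *)
Definition dart_unit (d e : dart A) : R := (e == d)%:R - (e == rev_dart d)%:R.

Lemma dart_unitN d e : dart_unit d (rev_dart e) = - dart_unit d e.
Proof.
by rewrite /dart_unit opprB -(inj_eq (inv_inj (@rev_dartK A))) rev_dartK (inj_eq (inv_inj (@rev_dartK A))).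
Qed.

Lemma inflow_dart_unit G d v : d.1 \in arcs G ->
  inflow G (dart_unit d) v = (dart_head G d == v)%:R - (dart_tail G d == v)%:R.
Proof.
move=> dG; rewrite inflow_darts; last exact: dart_unitN.
have sum1 (e : dart A) : e.1 \in arcs G ->
    \sum_(d0 : dart A | (d0.1 \in arcs G) && (dart_head G d0 == v)) (d0 == e)%:R =
    (dart_head G e == v)%:R :> R.
  move=> eG; have [hv|hv] := boolP (dart_head G e == v).
    rewrite (bigD1 e) ?eG //= eqxx big1 ?addr0 // => d0 /andP[_ /negbTE->] //.
  rewrite big1 // => d0 /andP[_ d0v]; case: eqP => // d0e.
  by rewrite -d0e d0v in hv.
by rewrite /dart_unit big_split /= sumrN !sum1 ?dart_head_rev.
Qed.

(** Induction on the residual path, extended at its end. The flow built so far is scaled down to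
    leave room for the new dart, so a path that repeats darts causes no trouble and need not be made
    simple. *)
Lemma augmenting_flow G c f s v : capacity_respecting G c f ->
    connect (residual_step G c f) s v ->
  exists (phi : dart A -> R) (eps : R),
    [/\ 0 < eps, flow_assignment G phi,
        capacity_respecting G c (fun d => f d + phi d) &
        forall w, inflow G phi w = eps * ((w == v)%:R - (w == s)%:R)].
Proof.
move=> fc /connectP[p + ->] {v}; elim/last_ind: p => [|p v IH].
  move=> _; exists (fun=> 0), 1; split=> //=.
  - by split=> // d; rewrite oppr0.
  - by move=> d dG; rewrite addr0 fc.
  - by move=> w; rewrite inflow0 subrr mulr0.
rewrite rcons_path last_rcons => /andP[/IH[phi [eps [eps0 [phiN phi0] phic phiin]]]].
case/existsP => d /and4P[dG /eqP du /eqP dv dc].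
(* The factors 2 reserve half of the residual room of [d] for the new dart and make the scaling
   factor at most one half. *)
have [del [del0 deleps delc]] : exists del : R,
    [/\ 0 < del, 2 * del <= eps & ((f d + 2 * del)%:E <= c d)%E].
  case E : (c d) dc => [r| |//]; last by exists (eps / 2); split; [lra|lra|rewrite leey].
  rewrite lte_fin => fr; exists (Num.min (eps / 2) ((r - f d) / 2)).
  rewrite lt_min lee_fin; case: (leP (eps / 2) ((r - f d) / 2)) => ?;
    by split; try (apply/andP; split); lra.
(* Scaling by [lam] lowers the excess at the old end of the path from [eps] to [del], which the new
   dart then carries away. *)
pose lam := del / eps.
have lam0 : 0 < lam by rewrite divr_gt0.
have lam2 : 2 * lam <= 1 by rewrite /lam mulrA ler_pdivrMr // mul1r.
have lamE : lam * eps = del by rewrite /lam divfK // gt_eqF.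
exists (fun e => lam * phi e + del * dart_unit d e), del; split=> //.
- split=> [e|e eG]; first by rewrite phiN dart_unitN; lra.
  rewrite phi0 // /dart_unit; have -> : (e == d) = false.
    by apply: contraNF eG => /eqP->.
  have -> : (e == rev_dart d) = false by apply: contraNF eG => /eqP->.
  by rewrite subrr !mulr0 addr0.
- move=> e eG; move: (fc _ eG) (phic _ eG).
  case E : (c e) => [r| |] //; last by rewrite !leey.
  rewrite !lee_fin => fr phir; rewrite /dart_unit.
  (* As [2 * lam <= 1], the scaled flow takes at most half of the room [r - f e]; on [d] the amount
     [del] takes at most the other half. *)
  have lphi : lam * phi e <= lam * (r - f e) by rewrite ler_pM2l //; lra.
  have [ed|ed] := eqVneq e d.
    have -> : (e == rev_dart d) = false.
      by rewrite ed; apply/negP => /eqP; case: (d) => a [].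
    rewrite -ed E lee_fin in delc; rewrite /= subr0 mulr1.
    have : 2 * lam * (r - f e) <= 1 * (r - f e) by rewrite ler_wpM2r //; lra.
    lra.
  have : 2 * lam * (r - f e) <= 1 * (r - f e) by rewrite ler_wpM2r //; lra.
  case: (e == rev_dart d); rewrite /=; lra.
- move=> w; rewrite inflowD !inflowZ phiin inflow_dart_unit // du dv.
  by rewrite ![_ == w]eq_sym mulrA lamE; lra.
Qed.

(** The cut is the set of nodes residually reachable from [S]. *)
Lemma separated_unreachable G c f S T : capacity_respecting G c f ->
    (forall s t, s \in S -> t \in T -> ~~ connect (residual_step G c f) s t) ->
  separated G c f S T.
Proof.
move=> fc ST; exists [set v | [exists s in S, connect (residual_step G c f) s v]]; split.
- apply/fintype.subsetP => s sS; rewrite inE; apply/existsP; exists s.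
  by rewrite sS connect0.
- apply/pred0Pn => -[t /= /andP[]]; rewrite inE => /existsP[s /andP[sS est]] tT.
  by have := ST _ _ sS tT; rewrite est.
- move=> d /and3P[dG]; rewrite !inE => /existsP[s /andP[sS esu]] /existsPn hd.
  have /negP nlt : ~~ ((f d)%:E < c d)%E.
    apply/negP => lt; move/negP: (hd s); apply; rewrite sS /=.
    apply: (connect_trans esu); apply: connect1; apply/existsP; exists d.
    by rewrite dG !eqxx.
  by apply/eqP; rewrite eq_le fc // andbT leNgt; apply/negP.
Qed.

Lemma saturated_connect G c f X u v : saturated G c f X -> u \in X ->
  connect (residual_step G c f) u v -> v \in X.
Proof.
move=> sX + /connectP[p + ->] {v}; elim: p u => [//|w p IH] u uX /= /andP[+ pw].
case/existsP => d /and4P[dG /eqP du /eqP dw dc]; apply: IH pw.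
apply: contraT => wX; have dX : leaves G X d by rewrite /leaves dG du uX dw.
by rewrite (sX _ dX) ltxx in dc.
Qed.

(** A saturated set is closed under residual steps, so the individual cuts rule out every residual
    path from [S] to [T], and reachability from [S] then yields a single cut. *)
Lemma separated_pointwise G c f S T : capacity_respecting G c f ->
    (forall s t, s \in S -> t \in T -> separated G c f [set s] [set t]) ->
  separated G c f S T.
Proof.
move=> fc ST; apply: separated_unreachable => // s t sS tT.
have [X [sX Xt satX]] := ST s t sS tT; rewrite finset.sub1set in sX.
by apply/negP => /(saturated_connect satX sX); rewrite (disjointFl Xt) // inE.
Qed.

Lemma max_flow_separated G c S T f : [disjoint S & T] ->
  max_flow G c S T f -> separated G c f S T.
Proof.
move=> dST [[fa fc f0] fmax]; apply: separated_unreachable => // s t sS tT.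
apply/negP => est.
have [phi [eps [eps0 [phiN phi0] phic phiin]]] := augmenting_flow fc est.
have sT : s \notin T by rewrite (disjointFr dST).
have /fmax : feasible_flow G c S T (fun d => f d + phi d).
  split=> //.
  - split=> d; first by rewrite fa.1 phiN opprD.
    by move=> dG; rewrite fa.2 // phi0 // addr0.
  - move=> v vG vST; rewrite inflowD f0 // phiin add0r.
    have [vt|_] := eqVneq v t; first by rewrite vt inE tT orbT in vST.
    have [vs|_] := eqVneq v s; first by rewrite vs inE sS in vST.
    by rewrite subrr mulr0.
rewrite /flow_value (eq_bigr _ (fun v _ => inflowD G f phi v)) big_split /=.
rewrite gerDl leNgt => /negP; apply; rewrite (bigD1 t) //= phiin eqxx.
have -> : (t == s) = false by apply: contraNF sT => /eqP<-.
rewrite subr0 mulr1 big1 ?addr0 // => v /andP[vT vt]; rewrite phiin (negbTE vt).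
have -> : (v == s) = false by apply: contraNF sT => /eqP<-.
by rewrite subrr mulr0.
Qed.

(** If the limit is not the minimum, the supremum is attained by [f]. *)
Lemma limited_max_flowP G c s t Delta f : limited_max_flow G c s t Delta f ->
  flow_value G [set t] f <= Delta /\
  (flow_value G [set t] f = Delta \/ max_flow G c [set s] [set t] f).
Proof.
move=> [ff].
set E := (X in ereal_sup X).
have ub := @ereal_sup_ubound R E.
case: (leP Delta%:E (ereal_sup E)) => [_ [->]|lt fE]; first by split=> //; left.
split; first by rewrite -lee_fin fE ltW.
right; split=> // g gf; rewrite -lee_fin fE; apply: ub.
by exists g.
Qed.

End MaxFlowCut.

(** * Saturated cuts under pushes of flow *)

Section Pushing.
Variables (R : realType) (V A : finType).
Implicit Types (G : digraph V A) (f g : dart A -> R) (c : dart A -> \bar R).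
Implicit Types (S T X W : {set V}).

Lemma residual_ge c f d r :
  (r%:E <= residual c f d)%E = ((f d + r)%:E <= c d)%E.
Proof.
by rewrite /residual; case: (c d) => [k| |] //=;
  rewrite ?leey // lee_fin lerBrDl.
Qed.

Lemma residual_eq c f d r : residual c f d = r%:E <-> c d = (f d + r)%:E.
Proof.
rewrite /residual; case: (c d) => [k| |] //=.
by split=> -[] h; congr (_%:E); lra.
Qed.

(** Saturation by the zero flow means zero capacity on every dart leaving [X]. The flow there is
    thus nonpositive, while its total vanishes because all terminals are on one side. *)
Lemma flow_across_saturated G c S T f X : wf_digraph G -> feasible_flow G c S T f ->
    saturated G c (fun=> 0) X ->
    S :|: T \subset X \/ [disjoint S :|: T & X] ->
  forall d, leaves G X d -> f d = 0.
Proof.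
move=> wfG ff sX side; have [[fN _] fc _] := ff.
apply: cut_flow_le0_eq0 => //.
  by move=> d dX; rewrite -lee_fin -(sX _ dX) fc //; case/and3P: dX.
by apply: sum_inflow_eq0 side => // v; apply: feasible_inflow0 ff.
Qed.

Lemma saturated_push G c S T f g X : wf_digraph G ->
    feasible_flow G (residual c f) S T g -> saturated G c f X ->
    S :|: T \subset X \/ [disjoint S :|: T & X] ->
  saturated G c (f \+ g) X.
Proof.
move=> wfG gf sX side d dX /=.
rewrite (flow_across_saturated wfG gf _ side dX) ?addr0 ?sX // => e eX.
by rewrite /residual sX // -EFinB subrr.
Qed.

End Pushing.

(** * Transfer between a graph and its extension by auxiliary arcs *)

Section Extension.
Variables (R : realType) (V V' A B : finType).
Implicit Types (H : digraph V A) (K : digraph V' (A + B)%type) (emb : V -> V').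
Implicit Types (f : dart A -> R) (g : dart (A + B)%type -> R) (c : dart A -> \bar R).

(** The common form of adding the apex, with [emb] equal to [Some], and of adding the artificial
    path, with [emb] the identity. *)
Definition extends emb H K : Prop :=
  injective emb /\
  forall a, [/\ (inl a \in arcs K) = (a \in arcs H),
    tail K (inl a) = emb (tail H a) & head K (inl a) = emb (head H a)].

Definition trace emb (X : {set V'}) : {set V} := [set v | emb v \in X].

Lemma leaves_inl emb H K X a b : extends emb H K ->
  leaves K X (inl a, b) = leaves H (trace emb X) (a, b).
Proof.
move=> [_ /(_ a)[aH tH hH]]; rewrite /leaves /dart_tail /dart_head /= aH tH hH.
by case: b; rewrite !inE.
Qed.

Lemma flow_assignment_drop emb H K g : extends emb H K ->
  flow_assignment K g -> flow_assignment H (drop_aux g).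
Proof.
move=> [_ ext] [gN g0]; split=> [d|d dH]; first exact: (gN (inl d.1, d.2)).
by apply: g0; case: (ext d.1) => ->.
Qed.

Lemma inflow_drop emb H K g v : extends emb H K ->
    (forall b, inr b \in arcs K ->
       (tail K (inr b) != emb v) && (head K (inr b) != emb v)) ->
  inflow H (drop_aux g) v = inflow K g (emb v).
Proof.
move=> [emb_inj ext] aux; rewrite /inflow !big_sumType /=.
rewrite [X in _ + X - _]big_pred0 ?[X in _ - (_ + X)]big_pred0 ?addr0; first last.
- by move=> b; apply/negP => /andP[/aux/andP[_ /negbTE->]].
- by move=> b; apply/negP => /andP[/aux/andP[/negbTE->]].
congr (_ - _); apply: eq_bigl => a; case: (ext a) => aH tH hH;
  by rewrite aH ?tH ?hH (inj_eq emb_inj).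
Qed.

Lemma capacity_respecting_drop emb H K c f S T g : extends emb H K ->
    feasible_flow K (aux_capacity (residual c f)) S T g ->
  capacity_respecting H c (f \+ drop_aux g).
Proof.
move=> [_ ext] [_ gc _] [a b] aH; rewrite -residual_ge.
by apply: (gc (inl a, b)); case: (ext a) => ->.
Qed.

Lemma saturated_drop emb H K c f g X : extends emb H K ->
    saturated K (aux_capacity (residual c f)) g X ->
  saturated H c (f \+ drop_aux g) (trace emb X).
Proof.
move=> ext sX [a b]; rewrite -(leaves_inl _ _ _ ext) => /sX.
by rewrite /aux_capacity /= => /residual_eq.
Qed.

(* A finite cut never separates the ends of an auxiliary arc. *)
Lemma saturated_aux K c f g X b :
    saturated K (aux_capacity (residual c f)) g X -> inr b \in arcs K ->
  (tail K (inr b) \in X) = (head K (inr b) \in X).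
Proof.
move=> sX bH; apply/idP/idP => [tX|hX]; apply: contraT => nX.
  by have := sX (inr b, true); rewrite /leaves /= bH tX nX => /(_ isT).
by have := sX (inr b, false); rewrite /leaves /= bH hX nX => /(_ isT).
Qed.

(** Since no auxiliary arc crosses [X], saturation of its trace says that [X] is saturated in [K] by
    the zero flow for the residual capacities; hence [g] is zero on the darts leaving it. *)
Lemma saturated_push_drop emb H K c f S T g X : extends emb H K ->
    wf_digraph K -> feasible_flow K (aux_capacity (residual c f)) S T g ->
    saturated H c f (trace emb X) ->
    (forall b, inr b \in arcs K -> (tail K (inr b) \in X) = (head K (inr b) \in X)) ->
    S :|: T \subset X \/ [disjoint S :|: T & X] ->
  saturated H c (f \+ drop_aux g) (trace emb X).
Proof.
move=> ext wfH gf sX aux side [a b] dX /=.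
have s0 : saturated K (aux_capacity (residual c f)) (fun=> 0) X.
  move=> [[e|e] k]; first by rewrite (leaves_inl _ _ _ ext) => /sX eX;
    rewrite /aux_capacity /= /residual eX -EFinB subrr.
  case/and3P; rewrite /dart_tail /dart_head /= => /aux.
  by case: k => -> ->.
have dX' : leaves K X (inl a, b) by rewrite (leaves_inl _ _ _ ext).
by rewrite /drop_aux /= (flow_across_saturated wfH gf s0 side dX') addr0 sX.
Qed.

End Extension.

Lemma disjointI (T : finType) (X Y : {set T}) :
  (forall x, x \in X -> x \notin Y) -> [disjoint X & Y].
Proof. by move=> XY; rewrite disjoint_subset; apply/fintype.subsetP. Qed.

(** * The two flows through the apex *)

Section Apex.
Variables (R : realType) (V A : finType).
Implicit Types (H : digraph V A) (P S T : {set V}) (f : dart A -> R) (c : dart A -> \bar R).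

Lemma apex_arc_inr H P v : (inr v \in arcs (add_apex H P)) = (v \in P).
Proof.
rewrite !inE (mem_imset _ _ inr_inj).
by case: imsetP => // -[].
Qed.

Lemma extends_apex H P : extends Some H (add_apex H P).
Proof.
split=> [u v []//|a]; split=> //; rewrite !inE (mem_imset _ _ inl_inj).
by rewrite orbC; case: imsetP => // -[].
Qed.

Lemma wf_add_apex H P : wf_digraph H -> P \subset nodes H -> wf_digraph (add_apex H P).
Proof.
move=> wfH /fintype.subsetP sPH [a|v].
  case: ((extends_apex H P).2 a) => -> _ _ /wfH[tH hH].
  by rewrite !inE /= !(mem_imset _ _ Some_inj).
by rewrite apex_arc_inr => /sPH vH; rewrite !inE /= (mem_imset _ _ Some_inj).
Qed.

(** The first flow leaves a cut [Y] between [S] and the apex, hence between [S] and [P], but [Y] may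
    contain nodes of [T]; intersecting it with the old cut [X] gives [Z], which avoids both. The
    second flow has its terminals outside [Z] and so preserves it. Its own cut [Y2] has the apex,
    hence [P], on the source side, and its union with [Z] separates [S :|: P] from [T]. *)
Lemma apex_phase_correct H P S T c f f2 : wf_digraph H -> P \subset nodes H ->
    [disjoint S & T] -> capacity_respecting H c f -> separated H c f S T ->
    apex_phase c H P S T f f2 ->
  [/\ flow_assignment H (fun d => f2 d - f d), capacity_respecting H c f2,
      forall v, v \notin P -> v \notin S :|: T -> inflow H (fun d => f2 d - f d) v = 0,
      separated H c f2 S (T :|: P) & separated H c f2 (S :|: P) T].
Proof.
move=> wfH sPH dST fc [X [/fintype.subsetP sSX dXT sX]] [g [h []]].
set K := add_apex H P; set f1 := f \+ drop_aux g => gmax hmax ->.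
have ext : extends Some H K := extends_apex H P.
have wfK : wf_digraph K by apply: wf_add_apex.
have auxP v : (inr v \in arcs K) = (v \in P) := apex_arc_inr H P v.
have inflow_drop_out (k : dart (A + V)%type -> R) v : v \notin P ->
    inflow H (drop_aux k) v = inflow K k (Some v).
  move=> vP; apply: inflow_drop ext _ => u; rewrite auxP => uP /=.
  by rewrite andbT; apply: contraNneq vP => -[<-].
have [gf hf] := (gmax.1, hmax.1).
have f1c : capacity_respecting H c f1 := capacity_respecting_drop ext gf.
have [gN _] := flow_assignment_drop ext (let: And3 ga _ _ := gf in ga).
have [Y [/fintype.subsetP sSY dYv sY]] : separated K (aux_capacity (residual c f))
    g [set Some v | v in S] [set None].
  by apply: max_flow_separated gmax; apply: disjointI => _ /imsetP[v _ ->]; rewrite inE.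
have YNone : None \notin Y by rewrite (disjointFl dYv) // inE.
have YP v : v \in P -> Some v \notin Y.
  by rewrite -auxP => /(saturated_aux sY) /= ->.
have sSY0 v : v \in S -> Some v \in Y by move=> vS; apply: sSY; apply: imset_f.
have sY1 : saturated H c f1 (trace Some Y) := saturated_drop ext sY.
(* The nodes of [Y] outside [X] carry no net inflow, while no flow can enter
   them from either side: uncrossing [Y] with the old cut [X]. *)
have g0 : forall d, leaves H (trace Some Y :\: X) d -> drop_aux g d = 0.
  apply: cut_flow_ge0_eq0 => // [d /and3P[dH]|].
    rewrite !inE negb_and negbK => /andP[tX tY] /orP[hX|hY].
      have : leaves H X (rev_dart d) by rewrite /leaves dart_tail_rev dart_head_rev dH hX.
      move/sX => cd; have := f1c (rev_dart d) dH; rewrite cd lee_fin /f1 /= gN; lra.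
    have : leaves H (trace Some Y) d by rewrite /leaves dH !inE tY.
    by move/sY1 => cd; have := fc d dH; rewrite cd lee_fin /f1 /=; lra.
  rewrite big1 // => v; rewrite !inE => /andP[vX vY].
  rewrite inflow_drop_out; last by apply: contraL vY => /YP.
  apply: (feasible_inflow0 wfK gf); rewrite !inE orbF.
  by apply: contra vX => /imsetP[u uS [->]]; apply: sSX.
pose Z := X :&: trace Some Y.
(* A dart leaving [Z] either leaves [Y], which is saturated by [f1], or enters [Y] minus [X]; in the
   latter case it leaves [X] and carries none of the new flow. *)
have sZ1 : saturated H c f1 Z.
  move=> d /and3P[dH]; rewrite !inE negb_and => /andP[tX tY].
  have [hY|hY _] := boolP (Some (dart_head H d) \in Y); last first.
    by apply: sY1; rewrite /leaves dH !inE tY.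
  rewrite orbF => hX; rewrite (sX d); last by rewrite /leaves dH tX.
  have : leaves H (trace Some Y :\: X) (rev_dart d).
    by rewrite /leaves dart_tail_rev dart_head_rev dH !inE hX hY tX.
  by move=> /g0; rewrite gN /f1 /= => /eqP; rewrite oppr_eq0 => /eqP->; rewrite addr0.
have [Y2 [/fintype.subsetP sY2 dY2T sY2']] : separated K (aux_capacity (residual c f1))
    h [set None] [set Some v | v in T].
  by apply: max_flow_separated hmax; apply: disjointI => v; rewrite !inE => /eqP->;
    apply/imsetP => -[].
have Y2None : None \in Y2 by apply: sY2; rewrite inE.
have sY22 := saturated_drop ext sY2'.
have ZP v : v \in P -> v \notin Z by move=> /YP vY; rewrite !inE (negbTE vY) andbF.
have sSZ v : v \in S -> v \in Z by move=> vS; rewrite !inE sSX // sSY0.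
have ZT v : v \in T -> v \notin Z by move=> vT; rewrite !inE (disjointFl dXT vT).
have trZ : trace Some (Some @: Z) = Z.
  by apply/setP => v; rewrite inE (mem_imset _ _ Some_inj).
have sZ2 : saturated H c (f1 \+ drop_aux h) Z.
  rewrite -trZ; apply: (saturated_push_drop ext wfK hf); rewrite ?trZ //.
    move=> v; rewrite auxP /= => /ZP/negbTE; rewrite (mem_imset _ _ Some_inj) => ->.
    by apply/esym/imsetP => -[].
  right; apply: disjointI => v; rewrite !inE => /orP[/eqP->|/imsetP[u uT ->]].
    by apply/imsetP => -[].
  by rewrite (mem_imset _ _ Some_inj) ZT.
have [ga ha] := (flow_assignment_drop ext (let: And3 ga _ _ := gf in ga),
                 flow_assignment_drop ext (let: And3 ha _ _ := hf in ha)).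
have dE d : (f1 \+ drop_aux h) d - f d = drop_aux g d + drop_aux h d.
  by rewrite /f1 /=; lra.
split.
- split=> [d|d dH]; rewrite !dE; first by rewrite ga.1 ha.1 opprD.
  by rewrite ga.2 // ha.2 // addr0.
- exact: capacity_respecting_drop ext hf.
- move=> v vP; rewrite inE negb_or => /andP[vS vT].
  rewrite (eq_inflow (g := fun d => drop_aux g d + drop_aux h d)); last by move=> d _.
  rewrite inflowD !inflow_drop_out //.
  rewrite (feasible_inflow0 wfK gf) ?(feasible_inflow0 wfK hf) ?addr0 //;
    by rewrite !inE (mem_imset _ _ Some_inj) ?orbF.
- exists Z; split=> //; first exact/fintype.subsetP.
  apply: disjointI => v vZ; rewrite finset.in_setU negb_or.
  by rewrite (contraL (@ZT v)) // (contraL (@ZP v)).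
- exists (trace Some Y2 :|: Z); split; last exact: saturatedU.
  + apply/fintype.subsetP => v; rewrite !inE => /orP[/sSZ|vP].
      by rewrite !inE => ->; rewrite orbT.
    by rewrite -auxP in vP; rewrite (saturated_aux sY2' vP) Y2None.
  + apply: disjointI => v; rewrite finset.in_setU => /orP[vY|vZ]; last by apply: contraL vZ => /ZT.
    apply/negP => vT; rewrite inE (disjointFl dY2T) // in vY.
    exact: imset_f.
Qed.

End Apex.

(** * The sweep along the boundary nodes *)

Lemma mem_zip2 (T1 T2 : eqType) (s : seq T1) (t : seq T2) x :
  x \in zip s t -> x.1 \in s /\ x.2 \in t.
Proof.
elim: s t => [|y s IH] [|z t] //=; rewrite !inE => /orP[/eqP->|/IH[-> ->]] /=.
  by rewrite !eqxx.
by rewrite !orbT.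
Qed.

(** Used with [a] membership in a cut: a cut crossed by no arc of the artificial path has the whole
    path on one side. *)
Lemma zip_behead_constant (T : eqType) (a : pred T) (x : T) s :
    (forall uw, uw \in zip (x :: s) s -> a uw.1 = a uw.2) ->
  forall y, y \in x :: s -> a y = a x.
Proof.
elim: s x => [|z s IH] x xs y; first by rewrite inE => /eqP->.
rewrite inE => /orP[/eqP->//|/IH->].
  by rewrite (xs (x, z)) // inE eqxx.
by move=> uw uws; apply: xs; rewrite inE uws orbT.
Qed.

Section Sweep.
Variables (R : realType) (V A : finType).
Implicit Types (H : digraph V A) (P S T X : {set V}) (f : dart A -> R)
  (c : dart A -> \bar R) (p q : seq V).

Lemma path_arc_inr H q uw : (inr uw \in arcs (add_path H q)) = (uw \in zip q (behead q)).
Proof.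
rewrite !inE (mem_imset _ _ inr_inj) inE.
by case: imsetP => // -[].
Qed.

Lemma extends_path H q : extends id H (add_path H q).
Proof.
split=> [//|a]; split=> //; rewrite !inE (mem_imset _ _ inl_inj).
by rewrite orbC; case: imsetP => // -[].
Qed.

Lemma wf_add_path H q : wf_digraph H -> {subset q <= nodes H} -> wf_digraph (add_path H q).
Proof.
move=> wfH sq [a|uw]; first by case: ((extends_path H q).2 a) => -> _ _ /wfH.
by rewrite path_arc_inr => /mem_zip2[/sq uH /mem_behead/sq wH].
Qed.

(** Induction on the sweep. The clause preserving every saturated [X] that does not split [p] serves
    twice: it carries the cut made in one iteration through the later ones, and it carries the cuts
    known before the sweep to its end. *)
Lemma boundary_sweep_correct H c p f f2 : wf_digraph H -> uniq p ->
    {subset p <= nodes H} -> boundary_sweep c H p f f2 -> capacity_respecting H c f ->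
  [/\ flow_assignment H (fun d => f2 d - f d), capacity_respecting H c f2,
      forall v, v \notin p -> inflow H f2 v = inflow H f v,
      forall X, saturated H c f X -> {in p &, forall x y, (x \in X) = (y \in X)} ->
        saturated H c f2 X &
      {in p &, forall x y, 0 < inflow H f2 x -> inflow H f2 y < 0 ->
        separated H c f2 [set x] [set y]}].
Proof.
move=> wfH + + run.
elim: run => {p f f2} [f|x f|x q r f f2 g step _ IH] Up sp fc.
- by split=> //; split=> *; rewrite !subrr ?oppr0.
- split=> //; first by split=> *; rewrite !subrr ?oppr0.
  by move=> u v; rewrite !inE => /eqP-> /eqP-> /lt_trans /[apply]; rewrite ltxx.
pose K := add_path H (q :: r).
have /andP[xqr Uqr] : (x \notin q :: r) && uniq (q :: r) by [].
have sqr : {subset q :: r <= nodes H} by move=> v vqr; apply: sp; rewrite inE vqr orbT.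
have xq : x != q by apply: contraNneq xqr => ->; rewrite mem_head.
have ext : extends id H K := extends_path H (q :: r).
have wfK : wf_digraph K by apply: wf_add_path.
have auxE uw : (inr uw \in arcs K) = (uw \in zip (q :: r) r) := path_arc_inr H (q :: r) uw.
have inflow_drop_out v : v \notin q :: r -> inflow H (drop_aux g) v = inflow K g v.
  move=> vqr; rewrite (inflow_drop g (v := v) ext) // => uw; rewrite auxE.
  by move=> /mem_zip2[uqr /(@mem_behead _ (q :: r)) wqr]; apply/andP;
    split; apply: contraNneq vqr => <-.
(* Both directions of the push at once: the limit keeps the inflow of [x] from changing sign, and
   either this inflow becomes zero or the push is a maximum flow. *)
have [s [t [st gst xval lim]]] : exists s t, [/\ [set s; t] = [set x; q],
    feasible_flow K (aux_capacity (residual c f)) [set s] [set t] g,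
    (0 < inflow H f x /\ inflow H f x + inflow K g x >= 0) \/
      (inflow H f x <= 0 /\ inflow H f x + inflow K g x <= 0) &
    inflow H f x + inflow K g x = 0 \/
      [/\ 0 < inflow H f x, s = x, t = q
        & max_flow K (aux_capacity (residual c f)) [set s] [set t] g] \/
      [/\ inflow H f x <= 0, s = q, t = x
        & max_flow K (aux_capacity (residual c f)) [set s] [set t] g]].
  have value s t : s != t ->
      feasible_flow K (aux_capacity (residual c f)) [set s] [set t] g ->
      flow_value K [set t] g = inflow K g t /\ inflow K g s = - inflow K g t.
    move=> st gf; split; first by rewrite /flow_value big_set1.
    have : \sum_(v in [set s; t]) inflow K g v = 0.
      have [[gN _] _ _] := gf.
      apply: (@sum_inflow_eq0 _ _ _ _ _ [set s; t]) => //; last by left.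
      by move=> v; apply: feasible_inflow0 gf.
    by rewrite big_setU1 ?inE //= big_set1; lra.
  have qx : q != x by rewrite eq_sym.
  case: ltP step => fx /[dup] -[gf _] /limited_max_flowP[].
    have [-> gx] := value _ _ xq gf => le lim; exists x, q; split=> //.
      by left; split=> //; lra.
    by case: lim => [?|?]; [left; lra | right; left; split].
  have [-> gx] := value _ _ qx gf.
  rewrite ler0_norm // => le lim; exists q, x; split=> //; first by rewrite finset.setUC.
    by right; split=> //; lra.
  by case: lim => [?|?]; [left; lra | right; right; split].
pose f1 := f \+ drop_aux g.
have f1c : capacity_respecting H c f1 := capacity_respecting_drop ext gst.
have [d2 f2c in2 keep2 sep2] := IH Uqr sqr f1c.
have f1x : inflow H f1 x = inflow H f x + inflow K g x.
  by rewrite /f1 inflowD inflow_drop_out.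
have ga := flow_assignment_drop ext (let: And3 ga _ _ := gst in ga).
split=> //.
- split=> [d|d dH]; first by have /= := d2.1 d; have := ga.1 d; lra.
  by have /= := d2.2 d dH; have := ga.2 d dH; lra.
- move=> v; rewrite inE negb_or => /andP[vx vqr].
  rewrite in2 // /f1 inflowD inflow_drop_out // (feasible_inflow0 wfK gst) ?addr0 //.
  by rewrite st !inE negb_or vx; apply: contraNneq vqr => ->; rewrite mem_head.
- move=> X sX side; apply: keep2; last first.
    by move=> u v uqr vqr; apply: side; rewrite inE ?uqr ?vqr orbT.
  have side1 u : u \in x :: q :: r -> (u \in X) = (x \in X).
    by move=> uin; apply: side; rewrite ?mem_head.
  (* Such an [X] is crossed by no artificial arc and has [x] and [q] on the same side, so the push
     preserves it. *)
  have trX : trace id X = X by apply/setP => v; rewrite inE.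
  rewrite -trX; apply: (saturated_push_drop ext wfK gst); rewrite ?trX //.
    move=> uw; rewrite auxE => /mem_zip2[uqr wr] /=.
    by rewrite !side1 // !inE ?wr ?orbT //; move: uqr; rewrite inE orbC => ->; rewrite orbT.
  rewrite st; have [xX|xX] := boolP (x \in X); [left|right].
    by apply/fintype.subsetP => v; rewrite !inE => /orP[/eqP->//|/eqP->]; rewrite (side1 q) ?inE ?eqxx ?orbT.
  by apply: disjointI => v; rewrite !inE => /orP[/eqP->//|/eqP->]; rewrite (side1 q) ?inE ?eqxx ?orbT.
(* A cut of the extended graph has all later boundary nodes on one side, so
   that the remaining iterations preserve it. *)
have cutK s' t' : max_flow K (aux_capacity (residual c f)) [set s'] [set t'] g ->
    s' != t' -> exists X, [/\ s' \in X, t' \notin X,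
      {in q :: r, forall y, (y \in X) = (q \in X)} & saturated H c f2 X].
  move=> gmax st'; have [X [sX Xt sat]] : separated K (aux_capacity (residual c f))
      g [set s'] [set t'].
    by apply: max_flow_separated gmax; rewrite disjoints1 inE.
  exists X; have side : {in q :: r, forall y, (y \in X) = (q \in X)}.
    apply: (@zip_behead_constant _ (mem X)) => uw uwr.
    by apply: (saturated_aux sat); rewrite auxE.
  split=> //; first by rewrite -finset.sub1set.
    by rewrite (disjointFl Xt) // inE.
  apply: keep2; last by move=> u v /side-> /side->.
  have := saturated_drop ext sat.
  by have -> : trace id X = X by apply/setP => v; rewrite inE.
(* The later iterations do not touch [x], so the sign of its final inflow tells which way the push
   went and that it was a maximum flow. *)
have f2x : inflow H f2 x = inflow H f x + inflow K g x by rewrite in2 // f1x.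
move=> {st} u v; rewrite ![_ \in x :: _]in_cons => /predU1P[->|uqr] /predU1P[->|vqr] hu hv;
  [by lra | | | exact: sep2].
- case: lim => [?|[[fx sx tq gmax]|[fx _ _ _]]]; [lra| |by case: xval => -[]; lra].
  rewrite sx tq in gmax; have [X [xX qX side sX]] := cutK _ _ gmax xq.
  exists X; split=> //; first by rewrite finset.sub1set.
  by rewrite disjoint_sym disjoints1 side.
- case: lim => [?|[[fx _ _ _]|[fx sx tq gmax]]]; [lra|by case: xval => -[]; lra|].
  rewrite sx tq in gmax; have qx : q != x by rewrite eq_sym.
  have [X [qX xX side sX]] := cutK _ _ gmax qx.
  exists X; split=> //; first by rewrite finset.sub1set side.
  by rewrite disjoint_sym disjoints1.
Qed.

End Sweep.

(** * Gluing cuts of two pieces *)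

Section Glue.
Variables (R : realType) (V A : finType).
Implicit Types (H : digraph V A) (P S T X N : {set V}) (E : {set A}) (f : dart A -> R)
  (c : dart A -> \bar R).

Lemma separated_sub H c f S T S' T' : S' \subset S -> T' \subset T ->
  separated H c f S T -> separated H c f S' T'.
Proof.
move=> sS sT [X [SX XT sX]]; exists X; split=> //; first exact: fintype.subset_trans SX.
apply: disjointI => v vX; apply/negP => /(fintype.subsetP sT).
by rewrite (disjointFr XT).
Qed.

Lemma separated_eq H c f f2 S T : (forall d, d.1 \in arcs H -> f d = f2 d) ->
  separated H c f S T -> separated H c f2 S T.
Proof.
move=> ff2 [X [SX XT sX]]; exists X; split=> // d /[dup] dX /and3P[dH _ _].
by rewrite sX // ff2.
Qed.

Lemma inflow_subdigraph H N E f v : E \subset arcs H ->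
    (forall d, d.1 \notin E -> f d = 0) ->
  inflow (subdigraph H N E) f v = inflow H f v.
Proof.
move=> /fintype.subsetP sE f0; rewrite /inflow /=; congr (_ - _);
  rewrite 2!big_mkcondr big_mkcond [RHS]big_mkcond; apply: eq_bigr => a _;
  by case: (boolP (a \in E)) => [/sE->//|/(f0 (a, true))->]; rewrite !if_same.
Qed.

(** Common nodes of the pieces lie in [P], which is on the same side of both cuts, so the cuts agree
    there; every arc lies in one piece, where its saturation is known. *)
Lemma separated_glue H N1 E1 N2 E2 P S1 T1 S2 T2 c f :
    wf_digraph (subdigraph H N1 E1) -> wf_digraph (subdigraph H N2 E2) ->
    arcs H \subset E1 :|: E2 -> N1 :&: N2 \subset P ->
    S1 :|: T1 \subset N1 -> S2 :|: T2 \subset N2 ->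
    P \subset S1 :&: S2 \/ P \subset T1 :&: T2 ->
    separated (subdigraph H N1 E1) c f S1 T1 ->
    separated (subdigraph H N2 E2) c f S2 T2 ->
  separated H c f (S1 :|: S2) (T1 :|: T2).
Proof.
move=> wf1 wf2 /fintype.subsetP HE /fintype.subsetP NP /fintype.subsetP N1s
  /fintype.subsetP N2s Pside
  [X1 [/fintype.subsetP SX1 XT1 sX1]] [X2 [/fintype.subsetP SX2 XT2 sX2]].
have agree v : v \in N1 -> v \in N2 -> (v \in X1) = (v \in X2).
  move=> vN1 vN2; have vP : v \in P by apply: NP; rewrite inE vN1.
  case: Pside => /fintype.subsetP/(_ v vP); rewrite inE => /andP[v1 v2].
    by rewrite SX1 ?SX2.
  by rewrite (disjointFl XT1) ?(disjointFl XT2).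
(* Each cut is restricted to its own piece, as it may contain arbitrary nodes elsewhere. *)
pose X := (X1 :&: N1) :|: (X2 :&: N2).
have XN1 v : v \in N1 -> (v \in X) = (v \in X1).
  move=> vN1; rewrite !inE vN1 andbT; have [vN2|_] := boolP (v \in N2).
    by rewrite (agree v) // andbT orbb.
  by rewrite andbF orbF.
have XN2 v : v \in N2 -> (v \in X) = (v \in X2).
  move=> vN2; rewrite !inE vN2 andbT; have [vN1|_] := boolP (v \in N1).
    by rewrite (agree v) // andbT orbb.
  by rewrite andbF.
exists X; split.
- apply/fintype.subsetP => v; rewrite inE => /orP[vS|vS].
    by rewrite XN1 ?SX1 // N1s // inE vS.
  by rewrite XN2 ?SX2 // N2s // inE vS.
- rewrite disjoint_sym; apply: disjointI => v; rewrite inE => /orP[vT|vT].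
    by rewrite XN1 ?(disjointFl XT1) // N1s // inE vT orbT.
  by rewrite XN2 ?(disjointFl XT2) // N2s // inE vT orbT.
- move=> d /and3P[dH tX hX]; have := HE _ dH; rewrite inE => /orP[dE|dE].
    have [tN hN] := (wf_dart_tail wf1 dE, wf_dart_head wf1 dE).
    by apply: sX1; rewrite /leaves dE -!XN1 //; apply/and3P.
  have [tN hN] := (wf_dart_tail wf2 dE, wf_dart_head wf2 dE).
  by apply: sX2; rewrite /leaves dE -!XN2 //; apply/and3P.
Qed.

End Glue.

(** * Topology of the separating curve *)

Section Separators.
Variables (R : realType) (V A : finType) (D : drawing R V A).
Implicit Types (H : digraph V A) (gamma : R -> R * R).

(** A connected set off the curve lies in one component of the complement. *)
Lemma strictly_inside_connected gamma (B : set (R * R)) x y : connected B ->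
    (B `&` curve_image gamma = set0)%classic -> B x -> B y ->
  strictly_inside gamma x -> strictly_inside gamma y.
Proof.
move=> Bc BC Bx By [_ bx]; have nC z : B z -> ~ curve_image gamma z.
  by move=> Bz Cz; have : (B `&` curve_image gamma)%classic z by []; rewrite BC.
split; first exact: nC.
have Bsub : (B `<=` ~` curve_image gamma)%classic by move=> z /nC.
by rewrite -(same_connected_component (connected_component_max Bx Bsub Bc By)).
Qed.

Lemma planar_embedding_sub H (N : {set V}) (E : {set A}) : N \subset nodes H ->
  E \subset arcs H -> planar_embedding H D -> planar_embedding (subdigraph H N E) D.
Proof.
move=> /fintype.subsetP sN /fintype.subsetP sE [h1 h2 h3 h4]; split.
- by move=> u v /sN uH /sN vH; apply: h1.
- by move=> a /sE; apply: h2.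
- by move=> a v /sE aH /sN vH; apply: h3.
- by move=> a b /sE aH /sE bH; apply: h4.
Qed.

Lemma arc_image_connected H a (i : interval R) : planar_embedding H D ->
    a \in arcs H -> ([set` i] `<=` `[0, 1])%classic ->
  connected (arc_curve D a @` [set` i])%classic.
Proof.
move=> [_ h2 _ _] aH isub; have [ac _ _ _] := h2 a aH.
apply: connected_continuous_connected; last exact: continuous_subspaceW ac.
by apply/connected_intervalP; apply: interval_is_interval.
Qed.

(* The half-closed arc ending at an end of [a] off the curve is connected and
   misses the curve. *)
Lemma strictly_inside_end H gamma a v x : planar_embedding H D ->
    a \in arcs H -> (open_arc D a `&` curve_image gamma = set0)%classic ->
    v = tail H a \/ v = head H a -> ~ curve_image gamma (node_pos D v) ->
    open_arc D a x ->
  strictly_inside gamma (node_pos D v) <-> strictly_inside gamma x.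
Proof.
move=> emb aH aC vend vC ax.
have [B [Bc BC Bv Bx]] : exists B : set (R * R), [/\ connected B,
    (B `&` curve_image gamma = set0)%classic, B (node_pos D v) & B x].
  have [_ h2 _ _] := emb; have [_ a0 a1 _] := h2 a aH.
  have {}aC t : 0 < t < 1 -> ~ curve_image gamma (arc_curve D a t).
    move=> t01 Ct; have : (open_arc D a `&` curve_image gamma)%classic (arc_curve D a t).
      by split=> //; exists t; rewrite //= in_itv.
    by rewrite aC.
  case: ax => u /=; rewrite in_itv /= => /andP[u0 u1] <-.
  case: vend => vE; rewrite vE in vC *.
    exists (arc_curve D a @` `[0, 1[)%classic; split.
    - apply: arc_image_connected emb aH _; by apply: subset_itv; rewrite bnd_simp.
    - apply/seteqP; split=> // _ [[t /= + <-]]; rewrite in_itv /= le_eqVlt.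
      move=> /andP[/orP[/eqP<-|t0] t1]; first by rewrite a0 => /vC.
      by move=> /aC; rewrite t0; apply.
    - by exists 0; rewrite //= in_itv /= lexx ltr01.
    - by exists u; rewrite //= in_itv /= (ltW u0).
  exists (arc_curve D a @` `]0, 1])%classic; split.
  - apply: arc_image_connected emb aH _; by apply: subset_itv; rewrite bnd_simp.
  - apply/seteqP; split=> // _ [[t /= + <-]]; rewrite in_itv /= [X in _ && X]le_eqVlt.
    move=> /andP[t0 /orP[/eqP->|t1]]; first by rewrite a1 => /vC.
    by move=> /aC; rewrite t0; apply.
  - by exists 1; rewrite //= in_itv /= lexx ltr01.
  - by exists u; rewrite //= in_itv /= u0 (ltW u1).
by split; apply: strictly_inside_connected Bc BC _ _.
Qed.

Lemma wf_inner_part H gamma : wf_digraph H -> planar_embedding H D ->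
  separator H D gamma -> wf_digraph (inner_part H D gamma).
Proof.
move=> wfH emb [_ aC _ _ _] a; rewrite inE => /andP[aH /asboolP ain].
have aendin v : v = tail H a \/ v = head H a -> v \in nodes (inner_part H D gamma).
  move=> vend; have vH : v \in nodes H by case: vend => ->; case: (wfH a aH).
  rewrite !inE vH /=; apply/orP.
  have [vC|vC] := pselect (curve_image gamma (node_pos D v)); [left|right];
    apply/asboolP => //.
  (* A sample point of the open arc, strictly inside because [a] is enclosed; its side is
     transferred to the end [v]. *)
  have ahalf : open_arc D a (arc_curve D a (2^-1)).
    by exists 2^-1; rewrite //= in_itv /=; apply/andP; split; lra.
  apply/(strictly_inside_end emb aH (aC a aH) vend vC ahalf); exact: ain.
by split; apply: aendin; [left|right].
Qed.

(** An arc with an end strictly inside has all its interior points inside, so it is enclosed. *)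
Lemma wf_outer_part H gamma : wf_digraph H -> planar_embedding H D ->
  separator H D gamma -> wf_digraph (outer_part H D gamma).
Proof.
move=> wfH emb [_ aC _ _ _] a /finset.setDP[aH]; rewrite inE aH => /asboolP anin.
have aendout v : v = tail H a \/ v = head H a -> v \in nodes (outer_part H D gamma).
  move=> vend; have vH : v \in nodes H by case: vend => ->; case: (wfH a aH).
  rewrite !inE vH /= andbT; apply/asboolP => vin; apply: anin => x ax.
  by apply/(strictly_inside_end emb aH (aC a aH) vend _ ax) => //; case: vin.
by split; apply: aendout; [left|right].
Qed.

(** Strictly increasing parameters in [[0, 1[] give distinct points of a Jordan curve. *)
Lemma boundary_order_uniq H gamma p : separator H D gamma ->
  boundary_order H D gamma p -> uniq p.
Proof.
move=> [[_ _ ginj] _ _ _ _] [_ [ts [tsort /allP tin tp]]].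
apply: (@map_uniq _ _ (node_pos D)); rewrite -tp map_inj_in_uniq.
  exact: (sorted_uniq lt_trans ltxx tsort).
by move=> s t /tin sin /tin tin'; apply: ginj; rewrite in_itv.
Qed.

End Separators.

(** * Returning the excess, and induction over executions *)

Section Correctness.
Variables (R : realType) (V A : finType) (c : dart A -> \bar R).
Variables (D : drawing R V A) (n0 : nat).
Implicit Types (H : digraph V A) (P S T : {set V}) (f : dart A -> R).

Lemma max_flow_eq_capacity (c1 c2 : dart A -> \bar R) H S T f :
    (forall d, d.1 \in arcs H -> c1 d = c2 d) ->
  max_flow H c1 S T f -> max_flow H c2 S T f.
Proof.
move=> cc; have feasE g : feasible_flow H c1 S T g <-> feasible_flow H c2 S T g.
  by split=> -[ga gc gin]; split=> // d dH; [rewrite -cc|rewrite cc] => //; apply: gc.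
by move=> [ff fmax]; split=> [|g /feasE/fmax//]; apply/feasE.
Qed.

(** The three separations merge pointwise into one cut [X] between [S :|: Pp] and [T :|: Pn]. The
    terminals of [g] all lie inside [X] and those of [h] outside, so both pushes preserve it. *)
Lemma return_excess_separated H P S T f f2 : wf_digraph H ->
    capacity_respecting H c f ->
    separated H c f S (T :|: P) -> separated H c f (S :|: P) T ->
    {in P &, forall x y, 0 < inflow H f x -> inflow H f y < 0 ->
      separated H c f [set x] [set y]} ->
    return_excess c H P S T f f2 ->
  [/\ flow_assignment H (fun d => f2 d - f d), capacity_respecting H c f2,
      forall v, v \notin P -> v \notin S :|: T -> inflow H f2 v = inflow H f v,
      forall v, v \in P -> inflow H f2 v = 0 &
      separated H c f2 S T].
Proof.
move=> wfH fc sepSTP sepSPT sepP [g [h [gf hf -> f2P]]].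
set Pp := [set p in P | 0 < inflow H f p] in gf.
set Pn := [set p in P | inflow H f p < 0] in hf.
set f1 := f \+ g in hf f2P *.
have [X [/fintype.subsetP SX XT sX]] : separated H c f (S :|: Pp) (T :|: Pn).
  apply: separated_pointwise => // s t; rewrite !inE.
  move=> /orP[sS|/andP[sP s0]] /orP[tT|/andP[tP t0]]; last exact: sepP.
  - by apply: separated_sub sepSTP; rewrite finset.sub1set ?inE ?sS ?tT.
  - by apply: separated_sub sepSTP; rewrite finset.sub1set ?inE ?sS ?tP ?orbT.
  - by apply: separated_sub sepSPT; rewrite finset.sub1set ?inE ?sP ?tT ?orbT.
have sX1 : saturated H c f1 X.
  apply: (saturated_push wfH gf sX); left; apply/fintype.subsetP => v vPS.
  by apply: SX; rewrite finset.setUC.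
have sX2 : saturated H c (f1 \+ h) X.
  apply: (saturated_push wfH hf sX1); right.
  by rewrite disjoint_sym.
have [ga _ _] := gf; have [ha hc _] := hf.
split=> //.
- split=> [d|d dH] /=; first by rewrite /f1 /= ga.1 ha.1; lra.
  by rewrite /f1 /= ga.2 // ha.2 //; lra.
- by move=> d dH; rewrite -residual_ge; apply: hc.
- move=> v vP; rewrite inE negb_or => /andP[vS vT]; rewrite /f1 !inflowD.
  rewrite (feasible_inflow0 wfH gf) ?(feasible_inflow0 wfH hf) ?addr0 ?addr0 //;
    by rewrite !inE (negbTE vP) /= ?orbF.
- exists X; split=> //; first by apply/fintype.subsetP => v vS; apply: SX; rewrite inE vS.
  apply: disjointI => v vX; apply/negP => vT.
  by have := disjointFr XT vX; rewrite inE vT.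
Qed.

(** The flow is global and may be nonzero outside [H] when a recursive call starts, so the claim
    concerns the difference [f2 d - f d], with [f] vanishing on the arcs of [H] only. *)
Lemma msms_max_flow_correct H S T f f2 : msms_max_flow c D n0 H S T f f2 ->
    wf_digraph H -> planar_embedding H D -> S \subset nodes H -> T \subset nodes H ->
    [disjoint S & T] -> (forall d, d.1 \in arcs H -> f d = 0) ->
  max_flow H c S T (fun d => f2 d - f d).
Proof.
elim=> {H S T f f2} [H S T f g _ gmax|H S T gamma p f0 f1 f2 f3 f4 f5 f6 _ sep ord P H1 H2
    _ IH1 apex1 _ IH2 apex2 sweep ret] wfH emb sSH sTH dST f00.
  have -> : (fun d => (f \+ g) d - f d) = g by apply: funext => d /=; lra.
  by apply: max_flow_eq_capacity gmax => d /f00 fd; rewrite /residual fd sube0.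
have wf1 : wf_digraph H1 := wf_inner_part wfH emb sep.
have wf2 : wf_digraph H2 := wf_outer_part wfH emb sep.
have sE1 : arcs H1 \subset arcs H by apply/fintype.subsetP => a; rewrite inE => /andP[].
have sE2 : arcs H2 \subset arcs H := finset.subsetDl _ _.
have PH v : v \in P -> v \in nodes H by rewrite inE => /andP[].
have sN1 : nodes H1 \subset nodes H.
  by apply/fintype.subsetP => v; rewrite !inE => /orP[]/andP[].
have sN2 : nodes H2 \subset nodes H := finset.subsetDl _ _.
have Pin v : v \in P -> v \notin inside_nodes H D gamma.
  rewrite !inE => /andP[-> /asboolP vC] /=; apply/asboolP => -[nvC _]; exact: nvC.
have sP1 : P \subset nodes H1 := finset.subsetUl _ _.
have sP2 : P \subset nodes H2.
  by apply/fintype.subsetP => v vP; rewrite finset.in_setD Pin //= PH.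
have N12 v : v \in nodes H -> (v \in nodes H1) || (v \in nodes H2).
  by move=> vH; rewrite finset.in_setU finset.in_setD vH andbT; case: (v \in inside_nodes _ _ _);
    rewrite ?orbT.
have NP : nodes H1 :&: nodes H2 \subset P.
  apply/fintype.subsetP => v.
  by rewrite finset.in_setI finset.in_setU finset.in_setD => /andP[/orP[//|->]].
have E12 a : a \in arcs H1 -> a \notin arcs H2 by move=> aE; rewrite finset.in_setD aE.
have dST1 : [disjoint S :&: nodes H1 & T :&: nodes H1].
  by apply: disjointI => v; rewrite !finset.in_setI => /andP[/(disjointFr dST)->].
have dST2 : [disjoint S :&: nodes H2 & T :&: nodes H2].
  by apply: disjointI => v; rewrite !finset.in_setI => /andP[/(disjointFr dST)->].
have in1 (d : dart A) : d.1 \in arcs H1 -> d.1 \in arcs H by move/(fintype.subsetP sE1).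
have in2 (d : dart A) : d.1 \in arcs H2 -> d.1 \in arcs H by move/(fintype.subsetP sE2).
(* The recursive call and the apex flows, treated alike for both pieces. *)
have phase K (f f' f'' : dart A -> R) : wf_digraph K -> P \subset nodes K ->
    [disjoint S :&: nodes K & T :&: nodes K] ->
    (forall d, d.1 \in arcs K -> f d = 0) ->
    max_flow K c (S :&: nodes K) (T :&: nodes K) (fun d => f' d - f d) ->
    apex_phase c K P (S :&: nodes K) (T :&: nodes K) f' f'' ->
  [/\ flow_assignment K (fun d => f'' d - f d), capacity_respecting K c f'',
      forall v, v \notin P -> v \notin S :|: T -> inflow K (fun d => f'' d - f d) v = 0,
      separated K c f'' (S :&: nodes K) ((T :&: nodes K) :|: P) &
      separated K c f'' ((S :&: nodes K) :|: P) (T :&: nodes K)].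
  move=> wfK sPK dK fK0 kmax; have [[ka kc kin] _] := kmax.
  have fE d : d.1 \in arcs K -> f' d - f d = f' d by move=> /fK0->; rewrite subr0.
  have f'c : capacity_respecting K c f' by move=> d dK'; rewrite -fE //; apply: kc.
  have := separated_eq fE (max_flow_separated dK kmax).
  move=> /(apex_phase_correct wfK sPK dK f'c) /[apply] -[da f''c din sepK1 sepK2].
  split=> // [|v vP vST].
    split=> [d|d dK']; first by have := ka.1 d; have := da.1 d; lra.
    by have := ka.2 d dK'; have := da.2 d dK'; lra.
  have vSTK : v \notin (S :&: nodes K) :|: (T :&: nodes K).
    by rewrite -finset.setIUl finset.in_setI (negbTE vST).
  rewrite (eq_inflow (g := fun d => (f'' d - f' d) + (f' d - f d))); last by move=> d _; lra.
  by rewrite inflowD din // (feasible_inflow0 wfK kmax.1) ?addr0.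
have emb1 : planar_embedding H1 D := planar_embedding_sub sN1 sE1 emb.
have emb2 : planar_embedding H2 D := planar_embedding_sub sN2 sE2 emb.
have f01 (d : dart A) : d.1 \in arcs H1 -> f0 d = 0 by move=> /in1/f00.
have max1 := IH1 wf1 emb1 (finset.subsetIr _ _) (finset.subsetIr _ _) dST1 f01.
have [d1 c1 i1 sep1a sep1b] := phase _ _ _ _ wf1 sP1 dST1 f01 max1 apex1.
(* The pieces have no common arc: work on the first leaves the second with zero flow, and work on
   the second keeps the cuts of the first. *)
have f22 (d : dart A) : d.1 \in arcs H2 -> f2 d = 0.
  move=> dE; have := d1.2 d; rewrite (contraL (@E12 d.1)) // => /(_ isT).
  by rewrite f00 ?in2 // subr0.
have max2 := IH2 wf2 emb2 (finset.subsetIr _ _) (finset.subsetIr _ _) dST2 f22.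
have [d2 c2 i2 sep2a sep2b] := phase _ _ _ _ wf2 sP2 dST2 f22 max2 apex2.
have f42 (d : dart A) : d.1 \in arcs H1 -> f2 d = f4 d.
  by move=> /E12/(d2.2 d)/eqP; rewrite subr_eq0 => /eqP.
have HE : arcs H \subset arcs H1 :|: arcs H2.
  by apply/fintype.subsetP => a aH; rewrite finset.in_setU finset.in_setD aH andbT orbN.
have c4 : capacity_respecting H c f4.
  move=> d /(fintype.subsetP HE); rewrite finset.in_setU => /orP[dE|dE]; last exact: c2.
  by rewrite -f42 //; apply: c1.
have cover (Q : {set V}) : Q \subset nodes H -> Q = (Q :&: nodes H1) :|: (Q :&: nodes H2).
  move=> /fintype.subsetP sQ; apply/setP => v; rewrite -finset.setIUr finset.in_setI finset.in_setU.
  by have [/sQ/N12->|] := boolP (v \in Q).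
have sep4a : separated H c f4 S (T :|: P).
  have := separated_glue wf1 wf2 HE NP _ _ _ (separated_eq f42 sep1a) sep2a.
  rewrite -cover // finset.setUACA -cover // finset.setUid; apply.
  - by rewrite !finset.subUset !finset.subsetIr.
  - by rewrite !finset.subUset !finset.subsetIr.
  - by right; rewrite finset.subsetI !finset.subsetUr.
have sep4b : separated H c f4 (S :|: P) T.
  have := separated_glue wf1 wf2 HE NP _ _ _ (separated_eq f42 sep1b) sep2b.
  rewrite finset.setUACA -!cover // finset.setUid; apply.
  - by rewrite !finset.subUset !finset.subsetIr sP1.
  - by rewrite !finset.subUset !finset.subsetIr sP2.
  - by left; rewrite finset.subsetI !finset.subsetUr.
have pP : p =i P by case: ord.
have pH : {subset p <= nodes H} by move=> v; rewrite pP => /PH.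
have [d5 c5 i5 keep sepP] :=
  boundary_sweep_correct wfH (boundary_order_uniq sep ord) pH sweep c4.
(* All of [P] is on the sink side of this cut, so the sweep preserves it; for the next one [P] is on
   the source side. *)
have sep5a : separated H c f5 S (T :|: P).
  have [X [SX XT sX]] := sep4a; exists X; split=> //; apply: keep => // u v.
  by rewrite !pP => uP vP; rewrite !(disjointFl XT) // inE ?uP ?vP orbT.
have sep5b : separated H c f5 (S :|: P) T.
  have [X [/fintype.subsetP SX XT sX]] := sep4b; exists X.
  split=> //; first exact/fintype.subsetP.
  by apply: keep => // u v; rewrite !pP => uP vP; rewrite !SX // inE ?uP ?vP orbT.
have sepP5 : {in P &, forall x y, 0 < inflow H f5 x -> inflow H f5 y < 0 ->
    separated H c f5 [set x] [set y]}.
  by move=> x y xP yP; apply: sepP; rewrite pP.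
have [d6 c6 i6 i6P sep6] := return_excess_separated wfH c5 sep5a sep5b sepP5 ret.
have f6E (d : dart A) : d.1 \in arcs H -> f6 d = f6 d - f0 d by move=> /f00->; rewrite subr0.
apply: separated_max_flow => //; last exact: separated_eq sep6.
have ext1 (d : dart A) : d.1 \notin arcs H -> d.1 \notin arcs H1 by apply/contra/in1.
have ext2 (d : dart A) : d.1 \notin arcs H -> d.1 \notin arcs H2 by apply/contra/in2.
split.
- split=> [d|d dH].
    by have := d1.1 d; have := d2.1 d; have := d5.1 d; have := d6.1 d; lra.
  have := d1.2 d (ext1 d dH); have := d2.2 d (ext2 d dH).
  by have := d5.2 d dH; have := d6.2 d dH; lra.
- by move=> d dH; rewrite -f6E //; apply: c6.
(* Boundary nodes are balanced by the return of excess. At other nonterminal nodes the sweep and the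
   return change nothing, and the contribution of each piece is conserved. *)
- move=> v vH vST; rewrite -(eq_inflow v f6E).
  have [vP|vP] := boolP (v \in P); first exact: i6P.
  rewrite i6 // i5 ?pP // (eq_inflow (g := fun d => (f4 d - f2 d) + (f2 d - f0 d))); last first.
    by move=> d /f00 fd; lra.
  have := i1 v vP vST; have := i2 v vP vST.
  rewrite !inflow_subdigraph //; [|exact: d1.2|exact: d2.2].
  by move=> inflow42 inflow20; rewrite inflowD inflow42 inflow20 addr0.
Qed.

End Correctness.

Theorem theorem1 (R : realType) (V A : finType) (G : digraph V A)
    (D : drawing R V A) (c : A -> R) (S T : {set V}) (n0 : nat)
    (f : dart A -> R)
    (hG : wf_digraph G)
    (hD : planar_embedding G D)
    (hc : forall a, a \in arcs G -> 0 <= c a)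
    (hS : S \subset nodes G)
    (hT : T \subset nodes G :\: S)
    (hrun : msms_max_flow (arc_capacity c) D n0 G S T (fun _ => 0) f) :
  max_flow G (arc_capacity c) S T f.
Proof.
have := msms_max_flow_correct hrun hG hD hS; move: hT.
rewrite finset.subsetD => /andP[sT dTS] /(_ sT).
rewrite disjoint_sym dTS => /(_ isT (fun _ _ => erefl)).
by have -> : (fun d => f d - 0) = f by apply: funext => d; rewrite subr0.
Qed.
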